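(* Let $X$ be a strictly convex reflexive Banach space, and let $T:X\to c_0$ be a compact linear operator. Then $$a_2(T)=c_2(T)<a_1(T)=c_1(T)=\|T\|.$$
   Context: A Banach space $X$ is strictly convex if for all $x,y\in X$ the equality $\|x+y\|=\|x\|+\|y\|$ can hold only if $x$ and $y$ are scalar multiples of each other. For $T\in B(X,Y)$ (a bounded linear operator between Banach spaces $X$ and $Y$) and $n\in\mathbb N$ ($n\geq 1$), the approximation numbers are $a_n(T)=\inf\{\|T-S\|: S\in B(X,Y),\ \mathrm{rank}\,S<n\}$ and the Gelfand numbers are $c_n(T)=\inf\{\|T|_E\|: E\subset X\text{ a closed subspace},\ \mathrm{codim}\,E<n\}$.
   Formalization: The operator T is assumed to be nonzero: for T = 0 all the numbers a_n(T), c_n(T) and ‖T‖ vanish, so the strict inequality c_2(T) < a_1(T) fails. *)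

(* Defs.v *)
From HB Require Import structures.
From mathcomp Require Import all_boot all_order all_algebra.
From mathcomp Require Import boolp classical_sets functions reals.
From mathcomp Require Import topology normedtype sequences.
From mathcomp Require Export complex.

Set Implicit Arguments.
Unset Strict Implicit.
Unset Printing Implicit Defensive.

Import Order.TTheory GRing.Theory Num.Theory.
Import numFieldNormedType.Exports.

Local Open Scope classical_set_scope.
Local Open Scope ring_scope.

(* Norms take values in the scalar field K itself. [supremum] and [infimum]
   are the least upper and greatest lower bounds for the (partial) order of K;
   in R[i] an upper bound of a nonempty set of real numbers, or a lower bound,
   is real, so that they agree with the bounds taken in R. *)

Section c0.
Variable K : numFieldType.

Definition null_sequence : {pred nat -> K^o} :=
  fun x => `[< x n @[n --> \oo] --> (0 : K) >].

Lemma null_sequence_submod_closed : submod_closed null_sequence.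
Proof.
split; first by apply/asboolP; exact: cvg_cst.
move=> a x y /asboolP x0 /asboolP y0; apply/asboolP.
rewrite -[0](addr0 (0 : K^o)) -[X in X + 0](scaler0 _ a).
by apply: cvgD => //; apply: cvgZl_tmp.
Qed.

HB.instance Definition _ :=
  GRing.isSubmodClosed.Build _ _ null_sequence null_sequence_submod_closed.

Record c0 := C0 { c0_val :> nat -> K^o ; c0P : c0_val \in null_sequence }.

HB.instance Definition _ := [isSub for c0_val].
HB.instance Definition _ := [Choice of c0 by <:].
HB.instance Definition _ := [SubChoice_isSubLmodule of c0 by <:].

Definition c0_norm (x : c0) : K := supremum 0 (range (fun n => `|x n|)).

Lemma c0_norm_max (x : c0) :
  exists2 m, c0_norm x = `|x m| & forall n, `|x n| <= `|x m|.
Proof.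
suff [m hm] : exists m, forall n, `|x n| <= `|x m|.
  exists m => //; rewrite /c0_norm /supremum ifF; last first.
    by apply/negbTE/set0P; exists `|x m|; exists m.
  apply: (is_subset1_supremums (A := range (fun n => `|x n|))).
    apply: (@xgetPex _ 0); exists `|x m|; split.
      by move=> _ [n _ <-].
    by move=> u; apply; exists m.
  split; first by move=> _ [n _ <-].
  by move=> u; apply; exists m.
have /asboolP x0 := c0P x.
have [h|/existsNP[p /eqP xp]] := pselect (forall n, x n = 0).
  by exists 0%N => n; rewrite !h.
have xp0 : 0 < `|x p| by rewrite normr_gt0.
have /cvgr0_norm_lt/(_ _ xp0)[N _ hN] := x0.
have [m hm] : exists m, forall n, (n < N)%N -> `|x n| <= `|x m|.
  elim: (N) => [|M [m hm]]; first by exists 0%N.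
  have /orP[h|h] : (`|x M| <= `|x m|) || (`|x m| <= `|x M|).
    by apply: real_leVge; exact: normr_real.
    exists m => n; rewrite ltnS leq_eqVlt => /orP[/eqP->//|]; exact: hm.
  exists M => n; rewrite ltnS leq_eqVlt => /orP[/eqP->//|/hm].
  by move=> /le_trans; apply.
have /orP[h|h] : (`|x p| <= `|x m|) || (`|x m| <= `|x p|).
  by apply: real_leVge; exact: normr_real.
  exists m => n; have [/hm//|Nn] := ltnP n N.
  by apply: (le_trans _ h); apply/ltW/hN.
exists p => n; have [/hm/le_trans->//|Nn] := ltnP n N.
by apply/ltW/hN.
Qed.

Lemma c0_ler_normD x y : c0_norm (x + y) <= c0_norm x + c0_norm y.
Proof.
have [m -> _] := c0_norm_max (x + y).
have [p -> hp] := c0_norm_max x; have [q -> hq] := c0_norm_max y.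
by apply: (le_trans (ler_normD (x m) (y m))); exact: lerD.
Qed.

Lemma c0_normrZ (l : K) x : c0_norm (l *: x) = `|l| * c0_norm x.
Proof.
have [m -> hm] := c0_norm_max (l *: x); have [p -> hp] := c0_norm_max x.
apply/eqP; rewrite eq_le; apply/andP; split.
  by rewrite [leLHS](normrM l (x m)) ler_wpM2l.
by rewrite -[leLHS](normrM l (x p)); exact: hm.
Qed.

Lemma c0_normr0_eq0 x : c0_norm x = 0 -> x = 0.
Proof.
have [m -> hm] := c0_norm_max x => xm; apply/val_inj/funext => n.
by apply/eqP; rewrite -normr_le0 -xm; exact: hm.
Qed.

HB.instance Definition _ :=
  Lmodule_isNormed.Build K c0 c0_ler_normD c0_normrZ c0_normr0_eq0.

End c0.

Section Operators.
Variables (K : numFieldType) (X Y : normedModType K).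

Definition opnorm_on (E : set X) (f : X -> Y) : K :=
  supremum 0 [set `|f x| | x in E `&` [set x | `|x| <= 1]].

Definition opnorm (f : X -> Y) : K := opnorm_on setT f.

Definition compact_operator (f : {linear X -> Y}) :=
  precompact (f @` [set x | `|x| <= 1]).

End Operators.

Section Dimension.
Variables (K : numFieldType) (V : lmodType K).

Definition has_dim (E : set V) (m : nat) :=
  exists b : 'I_m -> V, (forall i, E (b i)) /\
    forall x, E x -> exists! c : 'rV[K]_m, x = \sum_i c 0 i *: b i.

(* the classes of the [b i] form a basis of the quotient V / E *)
Definition has_codim (E : set V) (m : nat) :=
  exists b : 'I_m -> V,
    forall x, exists! c : 'rV[K]_m, E (x - \sum_i c 0 i *: b i).

End Dimension.

Definition subspace_set (K : numFieldType) (V : lmodType K) (E : set V) :=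
  submod_closed (mem E : {pred V}).

Section SNumbers.
Variables (K : numFieldType) (X Y : normedModType K).

Definition approximation_number (n : nat) (T : {linear X -> Y}) : K :=
  infimum 0 [set opnorm (fun x => T x - S x) | S in
    [set S : {linear X -> Y} |
       continuous S /\ exists2 m, (m < n)%N & has_dim (range S) m]].

Definition gelfand_number (n : nat) (T : {linear X -> Y}) : K :=
  infimum 0 [set opnorm_on E T | E in
    [set E | [/\ subspace_set E, closed E &
       exists2 m, (m < n)%N & has_codim E m]]].

End SNumbers.

Section Geometry.
Variables (K : numFieldType) (X : normedModType K).

Definition strictly_convex :=
  forall x y : X, `|x + y| = `|x| + `|y| ->
    (exists a : K, x = a *: y) \/ (exists a : K, y = a *: x).

Definition dual_pred : {pred X -> K^o} :=
  fun f => `[< (forall (a : K) (x y : X), f (a *: x + y) = a *: f x + f y) /\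
               continuous f >].

Lemma dual_pred_submod_closed : submod_closed dual_pred.
Proof.
split.
  apply/asboolP; split => [a x y|]; first by rewrite /= scaler0 addr0.
  by move=> x; exact: cvg_cst.
move=> a f g /asboolP[fl fc] /asboolP[gl gc]; apply/asboolP; split.
  move=> b x y; rewrite -[LHS]/(a *: f _ + g _) fl gl.
  rewrite -[X in _ = b *: X + _]/(a *: f x + g x).
  rewrite -[X in _ = _ + X]/(a *: f y + g y).
  by rewrite !scalerDr !scalerA addrACA (mulrC a).
by move=> x; apply: cvgD; [apply: cvgZl_tmp; exact: fc|exact: gc].
Qed.

HB.instance Definition _ :=
  GRing.isSubmodClosed.Build _ _ dual_pred dual_pred_submod_closed.

Record dual :=
  Dual { dual_val :> X -> K^o ; dualP : dual_val \in dual_pred }.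

HB.instance Definition _ := [isSub for dual_val].
HB.instance Definition _ := [Choice of dual by <:].
HB.instance Definition _ := [SubChoice_isSubLmodule of dual by <:].

(* every bounded linear functional on the dual, for the operator norm, is
   the evaluation at a point *)
Definition reflexive_space :=
  forall Phi : {linear dual -> K^o},
    (exists M : K, forall f : dual, `|Phi f| <= M * opnorm f) ->
    exists x : X, forall f : dual, Phi f = f x.

End Geometry.

(* Main.v *)
(* The n-th coordinates of T are functionals f_n, and compactness of T means
   that |f_n| -> 0. The equality a_2 = c_2 holds because a Hahn-Banach extension
   g_n of the restriction of f_n to a closed hyperplane E = ker phi differs from
   f_n by a multiple lambda_n phi with lambda_n -> 0, so that (g_n) = T - S with
   S of rank at most one and |T - S| = |T|_E|.
   For the strict inequality, only finitely many f_n satisfy |f_n| = |T|. By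
   reflexivity such an f_n attains its norm at a point x_n, unique up to scalars
   by strict convexity, and some functional phi is nonzero at all these x_n. The
   restriction of f_n to ker phi again attains its norm, so this norm is smaller
   than |T|. *)

Require Import Defs.
From HB Require Import structures.
From mathcomp Require Import all_boot all_order all_algebra.
From mathcomp Require Import boolp classical_sets functions reals.
From mathcomp Require Import topology normedtype sequences.
From mathcomp Require Import complex ring lra.

Set Implicit Arguments.
Unset Strict Implicit.
Unset Printing Implicit Defensive.

Import Order.TTheory GRing.Theory Num.Theory.
Import numFieldNormedType.Exports.

Local Open Scope classical_set_scope.
Local Open Scope ring_scope.

(** * The Hahn-Banach theorem over R and R[i] *)

Section RealHahnBanach.
Variables (R : realType) (K : nzRingType) (iota : {rmorphism R -> K}).
Variables (V : lmodType K) (p : V -> R).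
Hypothesis pD : forall x y, p (x + y) <= p x + p y.
Hypothesis pZ : forall t x, 0 <= t -> p (iota t *: x) = t * p x.

Definition dominated_graph (G : set (V * R)) :=
  (forall t x y a b, G (x, a) -> G (y, b) -> G (iota t *: x + y, t * a + b)) /\
  (forall x a, G (x, a) -> a <= p x).

(** Subtracting two values at [x] puts (0, d) in [G], hence t * d <= p 0 = 0 for every real t; the
    choice t = d leaves only d = 0. *)
Lemma dominated_graph_functional G x a b :
  dominated_graph G -> G (x, a) -> G (x, b) -> a = b.
Proof.
move=> [GL Gp] Ga Gb; pose d := a - b.
have G0 : G (0, d).
  have := GL (-1) x x b a Gb Ga.
  by rewrite rmorphN1 scaleN1r addNr mulN1r addrC.
(* The factor t - 1 is used because the pair (0, d) is also the second summand: (t - 1) d + d = t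
   d. *)
have Gt t : t * d <= 0.
  have p0 : p 0 = 0 by rewrite -[0 in LHS](scaler0 _ (iota 0)) pZ// mul0r.
  have := GL (t - 1) 0 0 d d G0 G0; rewrite scaler0 addr0 => /Gp.
  by rewrite p0 mulrBl mul1r subrK.
have := Gt d; rewrite -expr2 real_exprn_even_le0 ?num_real//= => /eqP.
by move=> /subr0_eq.
Qed.

(** The one-dimensional step of Hahn-Banach. By subadditivity every a - p (x - v) lies below every p
    (y + v) - b, so the supremum [c] of the former is an admissible value at [v]. *)
Lemma dominated_graph_extend G v : dominated_graph G -> G (0, 0) ->
  exists G', [/\ dominated_graph G', G `<=` G' & exists c, G' (v, c)].
Proof.
move=> [GL Gp] G0.
pose A := [set r | exists x a, G (x, a) /\ r = a - p (x - v)].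
have Aub y b : G (y, b) -> ubound A (p (y + v) - b).
  move=> Gb _ [x [a [Ga ->]]].
  have /Gp := GL 1 _ _ _ _ Ga Gb; rewrite rmorph1 scale1r mul1r => ab.
  have := pD (x - v) (y + v); rewrite addrACA addNr addr0; lra.
have A0 : A !=set0 by exists (0 - p (0 - v)), 0, 0.
pose c := sup A.
have cub y b : G (y, b) -> b + c <= p (y + v).
  move=> Gb; have := ge_sup A0 (Aub _ _ Gb); rewrite -/c; lra.
have clb x a : G (x, a) -> a - c <= p (x - v).
  move=> Ga; have : a - p (x - v) <= c.
    by apply: ub_le_sup; [exists (p (0 + v) - 0); exact: Aub|exists x, a].
  by lra.
exists [set z | exists x a t, G (x, a) /\ z = (x + iota t *: v, a + t * c)].
split; last 2 first.
- by move=> [x a] Ga; exists x, a, 0; rewrite rmorph0 scale0r mul0r !addr0.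
- by exists c, 0, 0, 1; rewrite rmorph1 scale1r mul1r !add0r.
split.
  move=> t _ _ _ _ [x [a [s [Ga [-> ->]]]]] [y [b [r [Gb [-> ->]]]]].
  exists (iota t *: x + y), (t * a + b), (t * s + r); split; first exact: GL.
  congr pair; last by ring.
  by rewrite scalerDr scalerA rmorphD rmorphM scalerDl addrACA.
move=> _ _ [x [a [t [Ga [-> ->]]]]].
have G1 s : G (iota s *: x, s * a).
  by have := GL s _ _ _ _ Ga G0; rewrite !addr0.
have p1 (s : R) (y : V) : s != 0 -> iota s *: (iota s^-1 *: y) = y.
  by move=> s0; rewrite scalerA -rmorphM mulfV// rmorph1 scale1r.
(* Dividing by |t| turns the claim into [cub] for t > 0 and into [clb] for t < 0. *)
have [t0|t0|->] := ltgtP t 0; last first.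
- by rewrite rmorph0 scale0r mul0r !addr0; exact: Gp.
- have tn0 : t != 0 by rewrite gt_eqF.
  rewrite -[x](p1 t)// -scalerDr pZ; last exact: ltW.
  rewrite -[a](mulKf tn0) mulrCA -mulrDr ler_pM2l//.
  exact/cub/G1.
- have t0' : 0 < - t by rewrite oppr_gt0.
  have tn0 : - t != 0 by rewrite gt_eqF.
  have -> : iota t *: v = - (iota (- t) *: v) by rewrite rmorphN scaleNr opprK.
  rewrite -[x](p1 (- t))// -scalerBr pZ; last exact: ltW.
  have -> : a + t * c = - t * ((- t)^-1 * a - c).
    by rewrite mulrBr mulVKf// mulNr opprK.
  by rewrite ler_pM2l//; exact/clb/G1.
Qed.

Lemma real_hahn_banach (E : set V) (phi : V -> R) :
    E 0 ->
    (forall t x y, E x -> E y -> E (iota t *: x + y)) ->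
    (forall t x y, E x -> E y -> phi (iota t *: x + y) = t * phi x + phi y) ->
    (forall x, E x -> phi x <= p x) ->
  exists F : V -> R,
    [/\ forall t x y, F (iota t *: x + y) = t * F x + F y,
        forall x, F x <= p x & forall x, E x -> F x = phi x].
Proof.
move=> E0 EL phiL phip.
pose G0 := [set z : V * R | E z.1 /\ z.2 = phi z.1].
(* Adjoining [G0] inside the property, instead of asking [G] to contain it, lets the empty chain,
   whose union is empty, satisfy it too. *)
have [|G [GG0 Gmax]] := @Zorn_bigcup _ (fun G => dominated_graph (G `|` G0)).
  move=> F FP Ftot; split; last first.
    move=> x a [[G FG Ga]|[/= Ex ->]]; last exact: phip.
    by have [_] := FP _ FG; apply; left.
  move=> t x y a b [[G FG Ga]|Gx] [[H FH Hb]|Gy].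
  + have [GH|HG] := Ftot _ _ FG FH.
      have [HL _] := FP _ FH.
      have [|||] := HL t x y a b; [left; exact: GH|by left|left|by right].
      by exists H.
    have [GL _] := FP _ FG.
    have [|||] := GL t x y a b; [by left|left; exact: HG|left|by right].
    by exists G.
  + have [GL _] := FP _ FG.
    have [|||] := GL t x y a b; [by left|by right|left|by right].
    by exists G.
  + have [GL _] := FP _ FH.
    have [|||] := GL t x y a b; [by right|by left|left|by right].
    by exists H.
  + right; case: Gx Gy => /= Ex -> [/= Ey ->].
    by split; [exact: EL|rewrite phiL].
have GG00 : (G `|` G0) (0, 0).
  right; split => //=; have := phiL (-1) 0 0 E0 E0.
  by rewrite scaler0 addr0 mulN1r addNr.
have Gtot v : exists c, (G `|` G0) (v, c).
  apply: contrapT => vG.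
  have [H [domH GH [c Hc]]] := dominated_graph_extend v GG0 GG00.
  apply: (Gmax H); last first.
    rewrite (_ : H `|` G0 = H)//; apply/seteqP; split; last by left.
    by move=> z [//|G0z]; apply: GH; right.
  split; first by move=> z Gz; apply: GH; left.
  by move=> HG; apply: vG; exists c; left; exact: HG.
have [F FG] := choice Gtot.
exists F; have [GL Gp] := GG0; split => //.
- move=> t x y; apply: (dominated_graph_functional GG0 (FG _)).
  exact: GL.
- by move=> x; exact/Gp/FG.
- move=> x Ex; apply: (dominated_graph_functional GG0 (FG _)).
  by right.
Qed.

End RealHahnBanach.

Lemma linear_bundle (K : nzRingType) (V W : lmodType K) (f : V -> W) :
  linear f -> exists F : {linear V -> W}, forall x, F x = f x.
Proof.
move=> fL; pose fm := GRing.isLinear.Build K V W *:%R f fL.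
pose F : {linear V -> W} := HB.pack f fm.
by exists F.
Qed.

(** Stated as a property of the scalar field, so that everything after its two proofs treats real
    and complex scalars at once. The functional [phi] is a total function constrained on [E]
    alone. *)
Definition hahn_banach (K : numFieldType) :=
  forall (V : lmodType K) (p : V -> K) (E : set V) (phi : V -> K),
    (forall x y, p (x + y) <= p x + p y) ->
    (forall a x, p (a *: x) = `|a| * p x) ->
    E 0 ->
    (forall a x y, E x -> E y -> E (a *: x + y)) ->
    (forall a x y, E x -> E y -> phi (a *: x + y) = a * phi x + phi y) ->
    (forall x, E x -> `|phi x| <= p x) ->
  exists F : {linear V -> K^o},
    (forall x, E x -> F x = phi x) /\ (forall x, `|F x| <= p x).

Lemma hahn_banach_real (R : realType) : hahn_banach R.
Proof.
move=> V p E phi pD pZ E0 EL phiL phip.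
have [|||||F [FL Fp FE]] := @real_hahn_banach R R idfun V p _ _ E phi E0.
- exact: pD.
- by move=> t x t0; rewrite pZ ger0_norm.
- exact: EL.
- exact: phiL.
- by move=> x /phip; exact/le_trans/ler_norm.
have [G GF] := @linear_bundle R V R^o F FL.
exists G; split => x; rewrite GF; first exact: FE.
rewrite ler_norml Fp andbT lerNl -(GF x).
rewrite (_ : - G x = G (- x)); last by rewrite linearN.
by rewrite GF (le_trans (Fp _))// -scaleN1r pZ normrN1 mul1r.
Qed.

Lemma seminorm_ge0 (K : numFieldType) (V : lmodType K) (p : V -> K) :
  (forall x y, p (x + y) <= p x + p y) ->
  (forall a x, p (a *: x) = `|a| * p x) -> forall x, 0 <= p x.
Proof.
move=> pD pZ x; have := pD x (- x).
rewrite subrr -(scale0r 0) pZ normr0 mul0r -[- x]scaleN1r pZ normrN1 mul1r.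
by rewrite -mulr2n pmulrn_lge0.
Qed.

(** The real theorem extends the real part of [phi] to [F], and x |-> F x - i F (i x) is then
    complex linear with real part [F]. *)
Lemma hahn_banach_complex (R : realType) : hahn_banach R[i].
Proof.
move=> V p E phi pD pZ E0 EL phiL phip.
have p_ge0 := seminorm_ge0 pD pZ.
have Re_le (z w : R[i]) : z <= w -> complex.Re z <= complex.Re w.
  by rewrite lecE => /andP[].
have ReD (z w : R[i]) : complex.Re (z + w) = complex.Re z + complex.Re w.
  by case: z; case: w.
have ReZ (t : R) (z : R[i]) : complex.Re (t%:C%C * z) = t * complex.Re z.
  by case: z => a b /=; rewrite mul0r subr0.
have Re_norm (z : R[i]) : complex.Re z <= complex.Re `|z|.
  by rewrite (le_trans (ler_norm _))//; have /Re_le := normc_ge_Re z.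
have [|||||F [FL Fp FE]] :=
    @real_hahn_banach R R[i] (real_complex R) V
      (fun x => complex.Re (p x)) _ _ E (fun x => complex.Re (phi x)) E0.
- by move=> x y; rewrite -ReD; exact/Re_le/pD.
- by move=> t x t0; rewrite pZ ger0_norm ?ler0c// ReZ.
- by move=> t; exact: EL.
- by move=> t x y Ex Ey; rewrite phiL// ReD ReZ.
- by move=> x Ex; rewrite (le_trans (Re_norm _))//; exact/Re_le/phip.
have FD x y : F (x + y) = F x + F y.
  by rewrite -{1}(scale1r x) -(rmorph1 (real_complex R)) FL mul1r.
have F0 : F 0 = 0 by apply: (@addIr _ (F 0)); rewrite -FD !addr0 add0r.
have FZ t x : F (t%:C%C *: x) = t * F x by rewrite -[_ *: x]addr0 FL F0 addr0.
have FN x : F (- x) = - F x.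
  by have := FZ (-1) x; rewrite rmorphN1 scaleN1r mulN1r.
pose I : R[i] := 'i%C.
pose G (x : V) : R[i] := (F x +i* - F (I *: x))%C.
have GD x y : G (x + y) = G x + G y.
  by rewrite /G scalerDr !FD opprD.
have II : I * I = -1 by rewrite -expr2 sqr_i.
have GZ a x : G (a *: x) = a * G x.
  case: a => s t; have -> : (s +i* t)%C = s%:C%C + I * t%:C%C.
    by rewrite [LHS]complexE.
  rewrite scalerDl GD mulrDl; congr (_ + _).
    rewrite /G scalerA [I * _]mulrC -scalerA !FZ; apply/eqP.
    by rewrite eq_complex /= !mul0r subr0 addr0 mulrN !eqxx.
  rewrite /G scalerA mulrA II mulN1r scaleNr FN [I * _]mulrC -scalerA !FZ.
  apply/eqP.
  rewrite eq_complex /=; apply/andP; split; apply/eqP; ring.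
have [H HG] : exists H : {linear V -> R[i]^o}, forall x, H x = G x.
  by apply: linear_bundle => a x y; rewrite GD GZ.
exists H; split => x; rewrite HG.
  move=> Ex; rewrite /G !FE//; last by rewrite -[I *: x]addr0; exact: EL.
  have phi0 : phi 0 = 0.
    by have := phiL (-1) 0 0 E0 E0; rewrite scaler0 addr0 mulN1r addNr.
  rewrite -[I *: x]addr0 phiL// phi0 addr0.
  by case: (phi x) => a b; congr Complex => /=; ring.
have [->|Gx0] := eqVneq (G x) 0; first by rewrite normr0.
(* Rotation by the unimodular [a] makes the value at [a *: x] equal to |G x|, hence real, so the
   bound on the real part bounds the modulus. *)
pose a := `|G x| / G x.
have na : `|a| = 1 by rewrite normrM normr_id normfV mulfV ?normr_eq0.
have GaE : G (a *: x) = `|G x| by rewrite GZ /a divfK.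
have := Fp (a *: x); rewrite pZ na mul1r.
have -> : F (a *: x) = complex.Re (G (a *: x)) by [].
rewrite GaE lecE => ->; rewrite andbT.
by rewrite !ger0_Im ?normr_ge0.
Qed.

(** The restriction to nonnegative elements makes this true in [R[i]], whose order compares only
    numbers with the same imaginary part. Sets of norms satisfy it. *)
Definition complete_reals (K : numFieldType) := forall A : set K,
  A !=set0 -> (forall a, A a -> 0 <= a) -> has_ubound A -> supremums A !=set0.

Lemma complete_reals_real (R : realType) : complete_reals R.
Proof.
move=> A A0 _ Aub; exists (sup A); split; first exact: ub_le_sup.
by move=> M AM; exact: ge_sup.
Qed.

Lemma complete_reals_complex (R : realType) : complete_reals R[i].
Proof.
move=> A [a0 Aa0] Age0 [M AM].
have ARe z : A z -> z = (complex.Re z)%:C%C by move=> /Age0/ger0_real/RRe_real.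
pose B := [set complex.Re z | z in A].
have B0 : B !=set0 by exists (complex.Re a0), a0.
have Bub : has_ubound B.
  exists (complex.Re M) => _ [z Az <-].
  by have := AM _ Az; rewrite lecE => /andP[].
exists (sup B)%:C%C; split.
  by move=> z Az; rewrite (ARe _ Az) lecR; apply: ub_le_sup => //; exists z.
(* An upper bound is comparable with the real number [a0], hence itself real. *)
move=> w Aw; have := Aw _ Aa0; rewrite [a0]ARe// !lecE /= => /andP[-> _] /=.
by apply: ge_sup => // _ [z Az <-]; have := Aw _ Az; rewrite lecE => /andP[].
Qed.

(** * Suprema and operator norms *)

Section Bounds.
Variables (K : numFieldType) (cK : complete_reals K).

Lemma supremum_lub (A : set K) :
  A !=set0 -> (forall a, A a -> 0 <= a) -> has_ubound A ->
  isLub A (supremum 0 A).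
Proof.
move=> A0 Age0 Aub; rewrite /supremum ifF; last exact/negbTE/set0P.
exact: xgetPex (cK A0 Age0 Aub).
Qed.

Lemma infimum_unique (A : set K) m :
  A !=set0 -> lbound A m -> ubound (lbound A) m -> infimum 0 A = m.
Proof.
move=> A0 Am mA; rewrite /infimum ifF; last exact/negbTE/set0P.
have inf_m : infimums A m by split.
apply: (is_subset1_infimums (A := A)) => //.
exact: (xgetPex _ (ex_intro _ m inf_m)).
Qed.

(** The infimum is obtained as the supremum of the nonnegative lower bounds, a set to which
    completeness applies. *)
Lemma infimum_glb (A : set K) :
  A !=set0 -> (forall a, A a -> 0 <= a) ->
  lbound A (infimum 0 A) /\ ubound (lbound A) (infimum 0 A).
Proof.
move=> [a0 Aa0] Age0; pose L := [set l | 0 <= l /\ lbound A l].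
have [Ls sL] : isLub L (supremum 0 L).
  apply: supremum_lub; first by exists 0.
    by move=> l [].
  by exists a0 => l [_]; exact.
have sA : lbound A (supremum 0 L) by move=> a Aa; apply: sL => l [_]; exact.
have As : ubound (lbound A) (supremum 0 L).
  move=> l Al; have s0 : 0 <= supremum 0 L by apply: Ls; split.
  (* A lower bound lies below a real number, so it is real and can be compared with 0. *)
  have lr : l \is Num.real by rewrite (ler_real (Al _ Aa0)) ger0_real ?Age0.
  have /orP[l0|l0] := real_leVge lr (real0 K); first exact: le_trans s0.
  exact: Ls.
by rewrite (infimum_unique (ex_intro _ a0 Aa0) sA As).
Qed.

Lemma ge_infimum (A : set K) a :
  (forall a, A a -> 0 <= a) -> A a -> infimum 0 A <= a.
Proof. by move=> A0 Aa; apply: (infimum_glb _ A0).1 => //; exists a. Qed.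

Lemma le_infimum (A : set K) l : A !=set0 -> (forall a, A a -> 0 <= a) ->
  (forall a, A a -> l <= a) -> l <= infimum 0 A.
Proof. by move=> An A0; exact: (infimum_glb An A0).2. Qed.

Variables (X Y : normedModType K).

(** On an unbounded set [supremum 0] returns its default 0; this condition makes [opnorm_on] a
    genuine least upper bound. *)
Definition ball_bounded (f : X -> Y) :=
  exists M, forall x, `|x| <= 1 -> `|f x| <= M.

Section OpnormOn.
Variables (E : set X) (f : X -> Y).
Hypothesis E0 : E 0.

Lemma opnorm_on_lub : ball_bounded f ->
  isLub [set `|f x| | x in E `&` [set x | `|x| <= 1]] (opnorm_on E f).
Proof.
move=> [M fM]; apply: supremum_lub.
- by exists `|f 0|, 0 => //; split => //=; rewrite normr0.
- by move=> _ [x _ <-].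
- by exists M => _ [x [_ x1] <-]; exact: fM.
Qed.

Lemma le_opnorm_on x : ball_bounded f -> E x -> `|x| <= 1 ->
  `|f x| <= opnorm_on E f.
Proof. by move=> /opnorm_on_lub[+ _] Ex x1; apply; exists x. Qed.

Lemma opnorm_on_ge0 : ball_bounded f -> 0 <= opnorm_on E f.
Proof.
by move=> fb; apply: (le_trans (normr_ge0 (f 0))); apply: le_opnorm_on => //;
  rewrite normr0.
Qed.

Lemma opnorm_on_le M : (forall x, E x -> `|x| <= 1 -> `|f x| <= M) ->
  ball_bounded f -> opnorm_on E f <= M.
Proof.
move=> fM /opnorm_on_lub[_]; apply => _ [x [Ex x1] <-]; exact: fM.
Qed.

Lemma le_opnorm_onM x : (forall a y, E y -> E (a *: y)) -> scalable f ->
  ball_bounded f -> E x -> `|f x| <= opnorm_on E f * `|x|.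
Proof.
move=> EZ fZ fb Ex; have [->|x0] := eqVneq x 0.
  by rewrite -[0](scale0r 0) fZ !scale0r !normr0 mulr0.
have nx : 0 < `|x| by rewrite normr_gt0.
have : `|f (`|x|^-1 *: x)| <= opnorm_on E f.
  apply: le_opnorm_on => //; first exact: EZ.
  by rewrite normrZ normfV normr_id mulVf// normr_eq0.
by rewrite fZ normrZ normfV normr_id mulrC ler_pdivrMr.
Qed.

End OpnormOn.

Lemma opnorm_on_subset (E F : set X) (f g : X -> Y) : E 0 -> F 0 ->
  ball_bounded f -> ball_bounded g ->
  (forall x, E x -> F x /\ f x = g x) -> opnorm_on E f <= opnorm_on F g.
Proof.
move=> E0 F0 fb gb EF; apply: opnorm_on_le => // x /EF[Fx ->] x1.
exact: le_opnorm_on.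
Qed.

Lemma bounded_continuous (f : {linear X -> Y}) M : 0 <= M ->
  (forall x, `|f x| <= M * `|x|) -> continuous f.
Proof.
move=> M0 fM; apply: bounded_linear_continuous; apply/linear_boundedP.
near=> r => x; apply: le_trans (fM x) _; apply: ler_wpM2r => //.
by near: r; apply: nbhs_pinfty_ge; exact: ger0_real.
Unshelve. all: by end_near. Qed.

Lemma continuous_ball_bounded (f : {linear X -> Y}) :
  continuous f -> ball_bounded f.
Proof.
move=> /linear_bounded_continuous/linear_boundedP/pinfty_ex_gt0[M M0 fM].
by exists M => x x1; rewrite (le_trans (fM x))// ler_piMr// ltW.
Qed.

End Bounds.

(** * Norm attaining functionals *)

Section Dual.
Variables (K : numFieldType) (cK : complete_reals K) (hbK : hahn_banach K).
Variable X : normedModType K.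

(** Hahn-Banach applied to t v |-> t p(v) on the line spanned by [v]. *)
Lemma hahn_banach_point (V : lmodType K) (p : V -> K) (v : V) :
  (forall x y, p (x + y) <= p x + p y) ->
  (forall a x, p (a *: x) = `|a| * p x) ->
  exists F : {linear V -> K^o}, F v = p v /\ forall x, `|F x| <= p x.
Proof.
move=> pD pZ; have p_ge0 := seminorm_ge0 pD pZ.
pose E := [set x | exists t, x = t *: v].
pose phi x : K := xget 0 [set t | x = t *: v] * p v.
(* For v = 0 the chosen coefficient is arbitrary, but t v = s v always gives |t - s| p(v) = 0, so
   the value is well defined. *)
have phiE t : phi (t *: v) = t * p v.
  rewrite /phi; set s := xget _ _.
  have sE : t *: v = s *: v.
    by apply: (xgetPex 0 (P := [set s | t *: v = s *: v])); exists t.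
  apply/eqP; rewrite -subr_eq0 -mulrBl -normr_eq0 normrM [`|p v|]ger0_norm//.
  by rewrite -pZ scalerBl sE subrr -(scale0r 0) pZ normr0 mul0r.
have EL a x y : E x -> E y -> E (a *: x + y).
  move=> [t ->] [s ->]; exists (a * t + s).
  by rewrite scalerA scalerDl.
have E0 : E 0 by exists 0; rewrite scale0r.
have [||F [FE Fp]] := @hbK V p E phi pD pZ E0 EL.
- move=> a _ _ [t ->] [s ->].
  by rewrite scalerA -scalerDl !phiE mulrDl mulrA.
- by move=> _ [t ->]; rewrite phiE normrM [`|p v|]ger0_norm// pZ.
exists F; split => //; rewrite FE; last by exists 1; rewrite scale1r.
by rewrite -[v in phi v]scale1r phiE mul1r.
Qed.

Lemma dual_linear (h : dual X) : linear (h : X -> K^o).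
Proof. by have /asboolP[] := dualP h. Qed.

Lemma dual_scalable (h : dual X) : scalable (h : X -> K^o).
Proof.
have [H HE] := linear_bundle (@dual_linear h).
by move=> a x; rewrite -!HE linearZ.
Qed.

Lemma dual0 (h : dual X) : h 0 = 0.
Proof. by rewrite -(scale0r 0) dual_scalable scale0r. Qed.

Lemma dual_ball_bounded (h : dual X) : ball_bounded (h : X -> K^o).
Proof.
have /asboolP[hL hc] := dualP h.
have [H HE] := linear_bundle hL.
have HhE : (H : X -> K^o) = h by apply/funext.
by rewrite -HhE; apply: continuous_ball_bounded; rewrite HhE.
Qed.

Lemma dual_bundle (f : X -> K^o) M : linear f -> 0 <= M ->
  (forall x, `|f x| <= M * `|x|) -> exists h : dual X, forall x, h x = f x.
Proof.
move=> fL M0 fM; have [F FE] := linear_bundle fL.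
have FfE : (F : X -> K^o) = f by apply/funext.
have fdual : f \in @dual_pred K X.
  apply/asboolP; split => //; rewrite -FfE.
  by apply: (bounded_continuous M0) => x; rewrite FE.
by exists (Dual fdual).
Qed.

Lemma norming_functional (x : X) :
  exists h : dual X, h x = `|x| /\ forall y, `|h y| <= `|y|.
Proof.
have [|F [Fx Fle]] := @hahn_banach_point X (fun y => `|y|) x (@ler_normD _ X).
  by move=> a y; rewrite normrZ.
have [|h hE] := @dual_bundle F 1 (linearP F) ler01.
  by move=> y; rewrite mul1r.
by exists h; split => [|y]; rewrite hE.
Qed.

Definition kernel (phi : dual X) : set X := [set x | phi x = 0].

Lemma kernel0 (phi : dual X) : kernel phi 0.
Proof. exact: dual0. Qed.

(* The seminorm [h |-> opnorm_on (kernel phi) h] on the dual vanishes at [phi];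
   hence so does every functional it dominates, and reflexivity represents such
   a functional by a point of the kernel. *)
Lemma kernel_norm_attained (phi f : dual X) : reflexive_space X ->
  exists x, [/\ phi x = 0, `|x| <= 1 & f x = opnorm_on (kernel phi) f].
Proof.
move=> rX; pose p (h : dual X) := opnorm_on (kernel phi) h.
have k0 := kernel0 phi.
have hb := dual_ball_bounded.
have ple (h : dual X) x : kernel phi x -> `|x| <= 1 -> `|h x| <= p h.
  by move=> kx x1; exact: le_opnorm_on.
have pD (h k : dual X) : p (h + k) <= p h + p k.
  apply: opnorm_on_le => // x kx x1.
  by apply: le_trans (ler_normD (h x) (k x)) _; apply: lerD; exact: ple.
have pZle a (h : dual X) : p (a *: h) <= `|a| * p h.
  apply: opnorm_on_le => // x kx x1.
  by rewrite [leLHS](normrM a (h x)) ler_wpM2l//; exact: ple.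
have pZ a (h : dual X) : p (a *: h) = `|a| * p h.
  apply/le_anti; rewrite pZle/=; have [->|a0] := eqVneq a 0.
    by rewrite normr0 mul0r; exact: opnorm_on_ge0.
  have na : 0 < `|a| by rewrite normr_gt0.
  rewrite -ler_pdivlMl// -normfV; apply: le_trans (pZle a^-1 _).
  by rewrite scalerA mulVf// scale1r.
have [Phi [Phif Phip]] := hahn_banach_point f pD pZ.
have p_opnorm (h : dual X) : p h <= opnorm h.
  by apply: opnorm_on_subset => //; split.
have [|x xE] := rX Phi.
  by exists 1 => h; rewrite mul1r (le_trans (Phip h)).
exists x; split.
- have : p phi <= 0.
    by apply: opnorm_on_le => // y ky _; rewrite [phi y]ky normr0.
  move=> /(le_trans (Phip phi)); rewrite normr_le0 => /eqP.
  by rewrite xE.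
(* A functional [h] of norm at most one that norms [x] gives |x| = |Phi h| <= p h <= opnorm h <=
   1. *)
- have [h [hx hle]] := norming_functional x.
  rewrite -[leLHS]normr_id -hx -xE (le_trans (Phip h))//.
  rewrite (le_trans (p_opnorm h))//.
  by apply: opnorm_on_le => // y _; exact/le_trans.
- by rewrite -xE.
Qed.

(** The kernel of the zero functional is the whole space. *)
Lemma norm_attained (f : dual X) : reflexive_space X ->
  exists2 x, `|x| <= 1 & f x = opnorm f.
Proof.
move=> /(kernel_norm_attained 0 f)[x [_ x1 fx]]; exists x => //.
by rewrite fx /opnorm; congr opnorm_on; apply/seteqP; split.
Qed.

(** Since f (x + y) = 2 t, the norm of x + y is at least 2, which forces equality in the triangle
    inequality. Hence [x] and [y] are proportional, and a zero of [phi] at [y] passes to [x]. *)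
Lemma strictly_convex_norming (phi f : dual X) x y : strictly_convex X ->
  0 < opnorm f -> `|x| <= 1 -> `|y| <= 1 -> f x = opnorm f -> f y = opnorm f ->
  phi y = 0 -> phi x = 0.
Proof.
set t := opnorm f => sX t0 x1 y1 fx fy phiy.
have fle z : `|f z| <= t * `|z|.
  apply: le_opnorm_onM => //; [exact: dual_scalable|exact: dual_ball_bounded].
have xy : `|x + y| = `|x| + `|y|.
  apply/le_anti; rewrite ler_normD/= (le_trans (lerD x1 y1))//.
  rewrite -(ler_pM2l t0) (le_trans _ (fle _))//.
  rewrite -[x]scale1r dual_linear scale1r fx fy.
  by rewrite gtr0_norm ?addr_gt0// mulrDr mulr1.
have [[a ->]|[a ya]] := sX _ _ xy; first by rewrite dual_scalable phiy scaler0.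
(* In the case y = a x, vanishing of [phi] at [y] yields it at [x] once [a] is known; [f] takes the
   same nonzero value at both points. *)
have a1 : a = 1.
  move: fy; rewrite ya dual_scalable fx => /eqP.
  by rewrite -subr_eq0 -[X in _ - X]scale1r -scalerBl scaler_eq0 subr_eq0
    (gt_eqF t0) orbF => /eqP.
by rewrite -phiy ya a1 scale1r.
Qed.

(** The natural numbers stay distinct in [K], which has characteristic zero, so a finite list misses
    one of them. *)
Lemma natural_avoiding (s : seq K) : exists n : nat, (n%:R : K) \notin s.
Proof.
apply: contrapT => /forallNP sn.
have : (size (iota 0 (size s).+1) <= size s)%N.
  rewrite -(size_map (fun n => n%:R : K)); apply: uniq_leq_size.
    by rewrite map_inj_uniq ?iota_uniq// => m n /eqP; rewrite eqr_nat => /eqP.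
  by move=> _ /mapP[n _ ->]; have /negP := sn n; rewrite negbK.
by rewrite size_iota ltnn.
Qed.

(** By induction, [phi] is corrected by a multiple m f_N. Each point with f_N (x_n) nonzero excludes
    one value of m; at the others the value of [phi] is unchanged. *)
Lemma functional_nonzero_at (P : nat -> Prop) (f : nat -> dual X)
    (x : nat -> X) N :
  (forall n, P n -> f n (x n) <> 0) ->
  exists phi : dual X, forall n, (n < N)%N -> P n -> phi (x n) <> 0.
Proof.
move=> fx; elim: N => [|N [phi phiN]]; first by exists 0.
have [PN|nPN] := pselect (P N); last first.
  by exists phi => n; rewrite ltnS leq_eqVlt => /orP[/eqP->//|]; exact: phiN.
have [m mN] := natural_avoiding (mkseq (fun n => - phi (x n) / f N (x n)) N.+1).
exists (m%:R *: f N + phi) => n nN Pn.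
rewrite -[(_ + _ : dual X) _]/(m%:R * f N (x n) + phi (x n)) => mphi.
have [fNn|fNn] := eqVneq (f N (x n) : K) 0.
  move: nN; rewrite ltnS leq_eqVlt => /orP[/eqP nN|nN].
    by apply: (fx N PN); rewrite -{2}nN.
  by apply: (phiN n nN Pn); rewrite -mphi fNn mulr0 add0r.
move/negP: mN; apply; apply/mapP; exists n; first by rewrite mem_iota.
by apply: (mulIf fNn); rewrite divfK//; apply/eqP; rewrite -addr_eq0 mphi.
Qed.

End Dual.

(** * Rank and codimension at most one *)

Section Dimension.
Variable K : numFieldType.

Lemma has_dim0P (V : lmodType K) (E : set V) :
  has_dim E 0 <-> forall x, E x -> x = 0.
Proof.
split => [[b [_ bE]] x /bE[c []]|E0]; first by rewrite big_ord0.
exists (fun=> 0); split => [[]//|x /E0->]; exists 0; split.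
  by rewrite big_ord0.
by move=> c _; rewrite thinmx0.
Qed.

Lemma has_codim0P (V : lmodType K) (E : set V) :
  has_codim E 0 <-> forall x, E x.
Proof.
split => [[b bE] x|ET]; first by have [c []] := bE x; rewrite big_ord0 subr0.
exists (fun=> 0) => x; exists 0; split; first exact: ET.
by move=> c _; rewrite thinmx0.
Qed.

Lemma has_dim_rank_one (V W : lmodType K) (phi : V -> K) (v : W) :
  scalable (phi : V -> K^o) ->
  exists2 m, (m < 2)%N & has_dim (range (fun x => phi x *: v)) m.
Proof.
move=> phiZ.
have [[u /eqP uv]|/forallNP phiv0] := pselect (exists u, phi u *: v <> 0);
  last first.
  exists 0%N => //; apply/has_dim0P => _ [x _ <-].
  by apply: contrapT; exact: phiv0.
exists 1%N => //; exists (fun=> phi u *: v); split; first by move=> _; exists u.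
have := uv; rewrite scaler_eq0 negb_or => /andP[pu v0].
move=> _ [x _ <-]; exists (const_mx (phi x / phi u)); split.
  by rewrite big_ord1 mxE scalerA divfK.
move=> c; rewrite big_ord1 scalerA => /eqP.
rewrite -subr_eq0 -scalerBl scaler_eq0 (negbTE v0) orbF subr_eq0 => /eqP xc.
by apply/rowP => i; rewrite mxE xc mulfK// (ord1 i).
Qed.

Lemma has_codim_kernel (V : lmodType K) (phi : V -> K) :
  linear (phi : V -> K^o) ->
  exists2 m, (m < 2)%N & has_codim [set x | phi x = 0] m.
Proof.
move=> /linear_bundle[F FE].
have [[u /eqP phiu]|/forallNP phi0] := pselect (exists u, phi u <> 0);
  last first.
  by exists 0%N => //; apply/has_codim0P => x; apply: contrapT; exact: phi0.
exists 1%N => //; exists (fun=> u) => x.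
have E c : (phi (x - \sum_(i < 1) c 0 i *: u) = 0) <->
    phi x = c 0 0 * phi u.
  rewrite big_ord1 -!FE linearB linearZ.
  by split => [/subr0_eq//|->]; exact: subrr.
exists (const_mx (phi x / phi u)); split; first by apply/E; rewrite mxE divfK.
by move=> c /E xc; apply/rowP => i; rewrite mxE xc mulfK// (ord1 i).
Qed.

(** Preimages of a basis of the range represent a basis of the quotient by the kernel. *)
Lemma has_codim_ker (V W : lmodType K) (S : {linear V -> W}) m :
  has_dim (range S) m -> has_codim [set x | S x = 0] m.
Proof.
move=> [b [bS bE]].
have /choice[u uE] : forall i, exists u, S u = b i.
  by move=> i; have [u _ <-] := bS i; exists u.
exists u => x; have [|c [cE cuniq]] := bE (S x); first by exists x.
have kerE d : S (x - \sum_i d 0 i *: u i) = 0 <->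
    S x = \sum_i d 0 i *: b i.
  rewrite linearB linear_sum.
  have -> : \sum_i S (d 0 i *: u i) = \sum_i d 0 i *: b i.
    by apply: eq_bigr => i _; rewrite linearZ uE.
  by split => [/subr0_eq//|->]; rewrite subrr.
by exists c; split => [|d] /=; [exact/kerE|move=> /kerE; exact: cuniq].
Qed.

(** In codimension one [phi] is the coordinate along [u] modulo [E], linear by uniqueness of
    coordinates and bounded because [E] is closed. In codimension zero both [u] and [phi] are 0. *)
Lemma closed_hyperplane (X : normedModType K) (E : set X) m :
  (m < 2)%N -> subspace_set E -> closed E -> has_codim E m ->
  exists (u : X) (phi : dual X),
    (forall x, E x <-> phi x = 0) /\ forall x, E (x - phi x *: u).
Proof.
move=> m2 [E0 EL] cE.
have {}E0 : E 0 by have := E0; rewrite inE.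
have {}EL a x y : E x -> E y -> E (a *: x + y).
  by move=> Ex Ey; have := EL a x y; rewrite !inE; apply.
have EZ a x : E x -> E (a *: x) by move=> Ex; rewrite -[_ *: _]addr0; exact: EL.
case: m m2 => [_ /has_codim0P ET|[_|//]].
  by exists 0, 0; split => // x; split => // _; exact: ET.
move=> [b bE]; pose u := b 0.
have /choice[phi phiE] : forall x, exists t : K, E (x - t *: u) /\
    forall s, E (x - s *: u) -> t = s.
  move=> x; have [c []] := bE x; rewrite big_ord1 => Ec cuniq.
  exists (c 0 0); split => // s Es.
  by rewrite (cuniq (const_mx s)) ?mxE// big_ord1 mxE.
have phiL : linear (phi : X -> K^o).
  move=> a x y; apply: (phiE _).2.
  rewrite -[a *: (phi x : K^o)]/(a * phi x) scalerDl opprD addrACA.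
  rewrite -scalerA -scalerBr.
  by apply: EL; [exact: (phiE x).1|exact: (phiE y).1].
have phiE0 x : E x <-> phi x = 0.
  split=> [Ex|x0]; first by apply: (phiE x).2; rewrite scale0r subr0.
  by have := (phiE x).1; rewrite x0 scale0r subr0.
have phiu : phi u = 1 by apply: (phiE u).2; rewrite scale1r subrr.
have nEu : ~ E u by move=> /phiE0; rewrite phiu => /eqP; rewrite oner_eq0.
have /nbhs_ballP[d /= d0 dE] : nbhs u (~` E).
  by apply: open_nbhs_nbhs; split => //; exact: closed_openC.
have dist_u e : E e -> d <= `|u - e|.
  move=> Ee; have /orP[//|ue] := real_leVge (gtr0_real d0) (normr_real (u - e)).
  have [//|] := eqVneq `|u - e| d => [->//|ned].
  by exfalso; apply: (dE e) => //; rewrite -ball_normE /= lt_neqAle ned.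
have phi_le x : `|phi x| <= d^-1 * `|x|.
  rewrite ler_pdivlMl//; have [->|px] := eqVneq (phi x) 0.
    by rewrite normr0 mulr0.
  have npx : 0 < `|phi x| by rewrite normr_gt0.
  rewrite -ler_pdivlMr// mulrC -normfV -normrZ.
  (* The vector x / phi x differs from [u] by an element of [E], so its norm is at least the
     distance bound [d]. *)
  rewrite (_ : (phi x)^-1 *: x = u - (- (phi x)^-1) *: (x - phi x *: u)).
    by apply: dist_u; apply: EZ; exact: (phiE x).1.
  by rewrite scaleNr opprK scalerBr scalerA mulVf// scale1r addrC subrK.
have d0' : 0 <= d^-1 by rewrite invr_ge0 ltW.
have [h hE] := dual_bundle phiL d0' phi_le.
by exists u, h; split => x; rewrite hE; [exact: phiE0|exact: (phiE x).1].
Qed.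

End Dimension.

(** * Compact operators into c0 *)

Section CompactOperator.
Variable K : numFieldType.

Lemma precompact_totally_bounded (Y : normedModType K) (A : set Y) (e : K) :
  0 < e -> precompact A ->
  exists D : seq Y, forall x, A x -> exists2 y, y \in D & `|x - y| < e.
Proof.
move=> e0; rewrite precompactE compact_cover.
move=> /(_ Y setT (fun y => ball y e))[|x _|D _ AD].
- by move=> y _; exact: ball_open.
- by exists x => //; exact: ballxx.
exists (finmap.enum_fset D) => x /subset_closure/AD[y Dy yx]; exists y => //.
by move: yx; rewrite -ball_normE /= distrC.
Qed.

Lemma c0_coord_le (y : c0 K) n : `|y n| <= `|y|.
Proof.
by have [m ym ymax] := c0_norm_max y; rewrite -[`|y|]/(c0_norm y) ym.
Qed.

Lemma c0_norm_le (y : c0 K) M : (forall n, `|y n| <= M) -> `|y| <= M.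
Proof.
by move=> yM; have [m ym _] := c0_norm_max y; rewrite -[`|y|]/(c0_norm y) ym.
Qed.

Lemma c0_small (y : c0 K) (e : K) : 0 < e ->
  exists N, forall n, (N <= n)%N -> `|y n| <= e.
Proof.
move=> e0; have /asboolP/cvgr0_norm_le/(_ _ e0)[N _ yN] := c0P y.
by exists N => n; exact: yN.
Qed.

Variables (X : normedModType K) (T : {linear X -> c0 K}).
Hypothesis cT : compact_operator T.

Lemma compact_operator_ball_bounded : ball_bounded T.
Proof.
have [D TD] := precompact_totally_bounded ltr01 cT.
exists (1 + \sum_(y <- D) `|y|) => x x1.
have [|y Dy Ty] := TD (T x); first by exists x.
rewrite -[T x](subrK y) (le_trans (ler_normD _ _))//.
apply: lerD; first exact: ltW.
rewrite (perm_big _ (perm_to_rem Dy)) big_cons lerDl.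
by apply: sumr_ge0.
Qed.

(** The finitely many members of an e/2-net of the image of the ball have a common index beyond
    which their coordinates are at most e/2. *)
Lemma compact_operator_tail (e : K) : 0 < e ->
  exists N, forall n x, (N <= n)%N -> `|x| <= 1 -> `|T x n| <= e.
Proof.
move=> e0; have e2 : 0 < e / 2 by rewrite divr_gt0.
have [D TD] := precompact_totally_bounded e2 cT.
have [N DN] : exists N, forall y, y \in D -> forall n, (N <= n)%N ->
    `|y n| <= e / 2.
  elim: (D) => [|y s [N sN]]; first by exists 0%N.
  have [M yM] := c0_small y e2; exists (maxn M N) => z.
  rewrite inE => /orP[/eqP->|zs] n; rewrite geq_max => /andP[Mn Nn].
    exact: yM.
  exact: sN.
exists N => n x Nn x1; have [|y Dy Ty] := TD (T x); first by exists x.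
rewrite -[T x n](subrK (y n)) (le_trans (ler_normD _ _))//.
rewrite [leRHS](splitr e) lerD//; last exact: DN.
exact: le_trans (c0_coord_le (T x - y) n) (ltW Ty).
Qed.

End CompactOperator.

(** * Approximation and Gelfand numbers *)

Section SNumbers.
Variables (K : numFieldType) (cK : complete_reals K) (hbK : hahn_banach K).
Variables (X : normedModType K) (T : {linear X -> c0 K}).
Hypothesis cT : compact_operator T.

Let Tb : ball_bounded T := compact_operator_ball_bounded cT.

Lemma coordinate_functional n : exists h : dual X, forall x, h x = T x n.
Proof.
have [M TM] := Tb.
have M0 : 0 <= M by rewrite (le_trans _ (TM 0 _)) ?normr0.
apply: (@dual_bundle _ _ (fun x => T x n) M) => //.
  by move=> a x y; rewrite linearP.
move=> x; apply: le_trans (c0_coord_le _ _) _.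
apply: (@le_trans _ _ (opnorm T * `|x|)).
  by apply: le_opnorm_onM => // a y; exact: linearZ.
by apply: ler_wpM2r => //; apply: opnorm_on_le => // y _; exact: TM.
Qed.

Lemma opnorm_on_rank0 (S : X -> c0 K) : (forall x, S x = 0) ->
  opnorm (fun x => T x - S x) = opnorm T.
Proof. by move=> S0; congr opnorm; apply/funext => x; rewrite S0 subr0. Qed.

Lemma approximation_set_nonempty n : (0 < n)%N ->
  [set S : {linear X -> c0 K} |
    continuous S /\ exists2 m, (m < n)%N & has_dim (range S) m] !=set0.
Proof.
move=> n0; exists \0; split; first by move=> x; exact: cvg_cst.
by exists 0%N => //; apply/has_dim0P => _ [x _ <-].
Qed.

Lemma subspace_setT : subspace_set [set: X].
Proof. by split => [|a x y _ _]; rewrite inE. Qed.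

Lemma gelfand_set_nonempty n : (0 < n)%N ->
  [set E : set X | [/\ subspace_set E, closed E &
     exists2 m, (m < n)%N & has_codim E m]] !=set0.
Proof.
move=> n0; exists setT; split; [exact: subspace_setT|exact: closedT|].
by exists 0%N => //; exact/has_codim0P.
Qed.

Lemma ball_bounded_sub (S : {linear X -> c0 K}) :
  continuous S -> ball_bounded (fun x => T x - S x).
Proof.
move=> /continuous_ball_bounded[M SM]; have [L TL] := Tb.
exists (L + M) => x x1; rewrite (le_trans (ler_normB _ _))// lerD//.
  exact: TL.
exact: SM.
Qed.

(** Rank zero forces S = 0, so the infimum runs over a single value. *)
Lemma approximation_number1 : approximation_number 1 T = opnorm T.
Proof.
have AE S : continuous (S : {linear X -> c0 K}) /\
    (exists2 m, (m < 1)%N & has_dim (range S) m) ->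
    opnorm (fun x => T x - S x) = opnorm T.
  move=> [_ [[|//] _ /has_dim0P S0]]; apply: opnorm_on_rank0 => x.
  by apply: S0; exists x.
have [S0 S0P] := approximation_set_nonempty (ltn0Sn 0).
apply: infimum_unique; first by exists (opnorm T), S0 => //; exact: AE.
  by move=> _ [S SP <-]; rewrite AE.
by move=> l; apply; exists S0 => //; exact: AE.
Qed.

Lemma gelfand_number1 : gelfand_number 1 T = opnorm T.
Proof.
have GE E : [/\ subspace_set E, closed E &
    exists2 m, (m < 1)%N & has_codim E m] -> opnorm_on E T = opnorm T.
  move=> [_ _ [[|//] _ /has_codim0P ET]]; congr opnorm_on.
  by apply/seteqP; split => // x _; exact: ET.
have [E0 E0P] := gelfand_set_nonempty (ltn0Sn 0).
apply: infimum_unique; first by exists (opnorm T), E0 => //; exact: GE.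
  by move=> _ [E EP <-]; rewrite GE.
by move=> l; apply; exists E0 => //; exact: GE.
Qed.

Lemma approximation_number_le n (S : {linear X -> c0 K}) : continuous S ->
  (exists2 m, (m < n)%N & has_dim (range S) m) ->
  approximation_number n T <= opnorm (fun x => T x - S x).
Proof.
move=> cS dS; apply: (ge_infimum cK); last by exists S.
by move=> _ [U [cU _] <-]; apply: opnorm_on_ge0 => //; exact: ball_bounded_sub.
Qed.

Lemma le_approximation_number n l : (0 < n)%N ->
  (forall S : {linear X -> c0 K}, continuous S ->
    (exists2 m, (m < n)%N & has_dim (range S) m) ->
    l <= opnorm (fun x => T x - S x)) ->
  l <= approximation_number n T.
Proof.
move=> n0 lS; apply: (le_infimum cK) => //.
- have [S SP] := approximation_set_nonempty n0.
  by exists (opnorm (fun x => T x - S x)), S.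
- move=> _ [S [cS _] <-]; apply: opnorm_on_ge0 => //.
  exact: ball_bounded_sub.
- by move=> _ [S [cS dS] <-]; exact: lS.
Qed.

Lemma gelfand_ge0 (E : set X) : subspace_set E -> 0 <= opnorm_on E T.
Proof. by move=> [E0 _]; apply: opnorm_on_ge0 => //; rewrite inE in E0. Qed.

Lemma gelfand_number_le n E : subspace_set E -> closed E ->
  (exists2 m, (m < n)%N & has_codim E m) -> gelfand_number n T <= opnorm_on E T.
Proof.
move=> sE cE dE; apply: (ge_infimum cK); last by exists E.
by move=> _ [F [sF _ _] <-]; exact: gelfand_ge0.
Qed.

Lemma le_gelfand_number n l : (0 < n)%N ->
  (forall E, subspace_set E -> closed E ->
    (exists2 m, (m < n)%N & has_codim E m) -> l <= opnorm_on E T) ->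
  l <= gelfand_number n T.
Proof.
move=> n0 lE; apply: (le_infimum cK) => //.
- by have [E EP] := gelfand_set_nonempty n0; exists (opnorm_on E T), E.
- by move=> _ [F [sF _ _] <-]; exact: gelfand_ge0.
- by move=> _ [E [sE cE dE] <-]; exact: lE.
Qed.

Lemma subspace_set_ker (V W : lmodType K) (S : {linear V -> W}) :
  subspace_set [set x | S x = 0].
Proof.
split => [|a x y]; rewrite !inE /= ?linear0// => Sx Sy.
by rewrite linearP Sx Sy scaler0 addr0.
Qed.

Lemma closed_ker (V W : normedModType K) (S : {linear V -> W}) :
  continuous S -> closed [set x | S x = 0].
Proof.
move=> cS; apply: (@closed_comp _ _ S [set 0]); first by move=> x _; exact: cS.
exact/accessible_closed_set1/hausdorff_accessible/norm_hausdorff.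
Qed.

(** The kernel of [S] has codimension equal to the rank of [S], and on it [T] agrees with T - S. *)
Lemma gelfand_le_approximation n : (0 < n)%N ->
  gelfand_number n T <= approximation_number n T.
Proof.
move=> n0; apply: le_approximation_number => // S cS [m mn dS].
apply: (@le_trans _ _ (opnorm_on [set x | S x = 0] T)).
  apply: gelfand_number_le; [exact: subspace_set_ker|exact: closed_ker|].
  by exists m => //; exact: has_codim_ker.
apply: opnorm_on_subset => //; [by rewrite /= linear0|exact: ball_bounded_sub|].
by move=> x ->; rewrite subr0.
Qed.

Lemma hyperplane_approximation (E : set X) m :
  (m < 2)%N -> subspace_set E -> closed E -> has_codim E m ->
  exists S : {linear X -> c0 K}, [/\ continuous S,
    exists2 m, (m < 2)%N & has_dim (range S) m &
    opnorm (fun x => T x - S x) <= opnorm_on E T].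
Proof.
move=> m2 sE cE dE.
have [u [phi [Ephi Esub]]] := closed_hyperplane m2 sE cE dE.
have E0 : E 0 by apply/Ephi; exact: dual0.
have EL a x y : E x -> E y -> E (a *: x + y).
  by rewrite !Ephi dual_linear => -> ->; rewrite scaler0 addr0.
have EZ a x : E x -> E (a *: x) by move=> Ex; rewrite -[_ *: _]addr0; exact: EL.
have [f fE] := choice coordinate_functional.
have fb n : ball_bounded (f n : X -> K^o) := dual_ball_bounded _.
pose c n := opnorm_on E (f n).
have c_ge0 n : 0 <= c n by exact: opnorm_on_ge0.
have /choice[g gP] : forall n, exists G : {linear X -> K^o},
    (forall x, E x -> G x = f n x) /\ forall x, `|G x| <= c n * `|x|.
  move=> n; apply: (hbK (p := fun x => c n * `|x|) (E := E)) => //.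
  - by move=> x y; rewrite -mulrDr ler_wpM2l// ler_normD.
  - by move=> a x; rewrite normrZ mulrCA.
  - by move=> a x y _ _; exact: dual_linear.
  - by move=> x Ex; apply: le_opnorm_onM => //; exact: dual_scalable.
have gE n x : E x -> g n x = f n x := (gP n).1 x.
have gle n x : `|g n x| <= c n * `|x| := (gP n).2 x.
(* The extension [g n] inherits the decay of [f n], since its bound [c n] is a norm of a restriction
   of [f n]. *)
have tail e : 0 < e -> exists N, forall n, (N <= n)%N ->
    forall x, `|f n x| <= e * `|x| /\ `|g n x| <= e * `|x|.
  move=> e0; have [N TN] := compact_operator_tail cT e0.
  exists N => n Nn x.
  have fne y : `|y| <= 1 -> `|f n y| <= e by rewrite fE; exact: TN.
  split.
    apply: (@le_trans _ _ (opnorm (f n) * `|x|)).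
      by apply: le_opnorm_onM => //; exact: dual_scalable.
    by apply: ler_wpM2r => //; apply: opnorm_on_le => // y _; exact: fne.
  apply: le_trans (gle n x) _; apply: ler_wpM2r => //.
  by apply: opnorm_on_le => // y _; exact: fne.
(* The difference f_n - g_n vanishes on [E], which contains x - phi(x) u; hence it equals phi times
   its value at [u]. *)
pose lam n : K^o := f n u - g n u.
have lam0 : lam \in @null_sequence K.
  apply/asboolP/cvgr0Pnorm_le => e e0.
  (* Adding 1 keeps the divisor positive when u = 0. *)
  have u1 : 0 < `|u| + 1 by rewrite ltr_wpDl.
  have e1 : 0 < e / 2 / (`|u| + 1) by rewrite !divr_gt0.
  have [N tN] := tail _ e1.
  exists N => // n /tN/(_ u)[fu gu].
  apply: le_trans (ler_normB _ _) _; rewrite [leRHS](splitr e).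
  have eu : e / 2 / (`|u| + 1) * `|u| <= e / 2.
    by rewrite mulrAC ler_pdivrMr// ler_wpM2l ?lerDl// ltW// divr_gt0.
  by apply: lerD; [exact: le_trans fu eu|exact: le_trans gu eu].
pose v : c0 K := C0 lam0.
have [S SE] : exists S : {linear X -> c0 K}, forall x, S x = phi x *: v.
  apply: linear_bundle => a x y.
  by rewrite dual_linear scalerDl scalerA.
have SM x : `|S x| <= opnorm phi * `|v| * `|x|.
  rewrite SE normrZ mulrAC ler_wpM2r//.
  apply: le_opnorm_onM => //; [exact: dual_scalable|exact: dual_ball_bounded].
have cS : continuous S.
  apply: (bounded_continuous _ SM); rewrite mulr_ge0// opnorm_on_ge0//.
  exact: dual_ball_bounded.
have TSE n x : (T x - S x) n = g n x.
  rewrite SE -[LHS]/(T x n - phi x * lam n) -fE.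
  have [F FE] := linear_bundle (@dual_linear _ _ (f n)).
  have gf : g n x - phi x * g n u = f n x - phi x * f n u.
    by have := gE n _ (Esub x); rewrite -FE !linearB !linearZ !FE.
  by rewrite mulrBr opprB addrCA -gf addrC subrK.
exists S; split => //.
  have -> : (S : X -> _) = fun x => phi x *: v by apply/funext.
  exact/has_dim_rank_one/dual_scalable.
apply: opnorm_on_le => //; last exact: ball_bounded_sub.
move=> x _ x1; apply: c0_norm_le => n; rewrite TSE.
apply: le_trans (gle n x) _; apply: (@le_trans _ _ (c n)).
  by rewrite ler_piMr.
apply: opnorm_on_le => // y Ey y1; rewrite fE.
apply: le_trans (c0_coord_le _ _) _; exact: le_opnorm_on.
Qed.

Lemma approximation_eq_gelfand : approximation_number 2 T = gelfand_number 2 T.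
Proof.
apply/le_anti; rewrite gelfand_le_approximation// andbT.
apply: le_gelfand_number => // F sF cF [m m2 dF].
have [S [cS dS leS]] := hyperplane_approximation m2 sF cF dF.
by apply: le_trans leS; exact: approximation_number_le.
Qed.

Lemma gelfand_number2_lt : strictly_convex X -> reflexive_space X ->
  (exists x, T x <> 0) -> gelfand_number 2 T < opnorm T.
Proof.
move=> sX rX [x0 /eqP Tx0]; pose t := opnorm T.
have t0 : 0 < t.
  rewrite lt_neqAle opnorm_on_ge0// andbT eq_sym; apply/eqP => t0.
  have : `|T x0| <= t * `|x0| by apply: le_opnorm_onM => // a y; exact: linearZ.
  by rewrite t0 mul0r normr_le0 (negbTE Tx0).
have [f fE] := choice coordinate_functional.
have fb n : ball_bounded (f n : X -> K^o) := dual_ball_bounded _.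
have ft n : opnorm (f n) <= t.
  apply: opnorm_on_le => // x _ x1; rewrite fE.
  by apply: le_trans (c0_coord_le _ _) _; exact: le_opnorm_on.
have /choice[x xP] : forall n, exists x, `|x| <= 1 /\ f n x = opnorm (f n).
  by move=> n; have [x x1 fx] := norm_attained cK hbK (f n) rX; exists x.
(* Beyond [N] the coordinate functionals have norm at most t/2, strictly below [t], so only n < N
   needs an argument. *)
have t2 : 0 < t / 2 by rewrite divr_gt0.
have [N TN] := compact_operator_tail cT t2.
have [n Pn|phi phiP] :=
    @functional_nonzero_at _ _ (fun n => opnorm (f n) = t) f x N.
  by rewrite (xP n).2 Pn; apply/eqP; rewrite gt_eqF.
have k0 := kernel0 phi.
(* Otherwise f_n has norm [t], attained at [x n] and also at a point of the kernel; strict convexity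
   then gives phi (x n) = 0, against the choice of [phi]. *)
have lt_t n : (n < N)%N -> opnorm_on (kernel phi) (f n) < t.
  move=> nN; have le_t : opnorm_on (kernel phi) (f n) <= opnorm (f n).
    by apply: opnorm_on_subset => //; split.
  rewrite lt_neqAle (le_trans le_t)// andbT; apply/eqP => kt.
  have fnt : opnorm (f n) = t by apply/le_anti; rewrite ft -kt.
  have [y [phiy y1 fy]] := kernel_norm_attained cK hbK phi (f n) rX.
  apply: (phiP n nN fnt).
  apply: (strictly_convex_norming cK (f := f n) (y := y)) => //.
  - by rewrite fnt.
  - exact: (xP n).1.
  - exact: (xP n).2.
  - by rewrite fy kt fnt.
(* [M] is the maximum of t/2 and the finitely many restricted norms, built by induction because the
   order of [K] is total only on real elements. *)
have [M [tM Mt fM]] : exists M, [/\ t / 2 <= M, M < t &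
    forall n, (n < N)%N -> opnorm_on (kernel phi) (f n) <= M].
  elim: N {TN phiP} lt_t => [|N IH] lt_t.
    exists (t / 2); split => //; rewrite ltr_pdivrMr//.
    by rewrite mulr_natr mulr2n ltrDl.
  have [n nN|M [tM Mt fM]] := IH; first exact/lt_t/ltnW.
  have Mr : M \is Num.real by rewrite -(ler_real tM) ger0_real// ltW// divr_gt0.
  have fr : opnorm_on (kernel phi) (f N) \is Num.real.
    by rewrite ger0_real// opnorm_on_ge0.
  have /orP[Mf|fM'] := real_leVge Mr fr; last first.
    exists M; split => // n; rewrite ltnS leq_eqVlt => /orP[/eqP->//|].
    exact: fM.
  exists (opnorm_on (kernel phi) (f N)); split; first exact: le_trans Mf.
    exact: lt_t.
  move=> n; rewrite ltnS leq_eqVlt => /orP[/eqP->//|/fM]; move/le_trans; exact.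
apply: le_lt_trans Mt; apply: (@le_trans _ _ (opnorm_on (kernel phi) T)).
  have [F FE] := linear_bundle (@dual_linear _ _ phi).
  have FphiE : (F : X -> K^o) = phi by apply/funext.
  have kE : kernel phi = [set y | F y = 0] by rewrite FphiE.
  apply: gelfand_number_le; [| |exact/has_codim_kernel/dual_linear].
    by rewrite kE; exact: subspace_set_ker.
  rewrite kE; apply: closed_ker; rewrite FphiE.
  by have /asboolP[] := dualP phi.
apply: opnorm_on_le => // y ky y1; apply: c0_norm_le => n.
have [nN|Nn] := ltnP n N; last by apply: le_trans tM; exact: TN.
rewrite -fE; apply: le_trans (fM n nN); exact: le_opnorm_on.
Qed.

End SNumbers.

(** * Specialization to real and complex scalars *)

Lemma real_or_complex_complete (R : realType) (K : numFieldType) :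
  K = (R : numFieldType) \/ K = (R[i] : numFieldType) -> complete_reals K.
Proof.
by case=> ->; [exact: complete_reals_real|exact: complete_reals_complex].
Qed.

Lemma real_or_complex_hahn_banach (R : realType) (K : numFieldType) :
  K = (R : numFieldType) \/ K = (R[i] : numFieldType) -> hahn_banach K.
Proof.
by case=> ->; [exact: hahn_banach_real|exact: hahn_banach_complex].
Qed.

Unset Implicit Arguments.

(** Hypothesis [T0] excludes the zero operator, for which all these numbers are 0 and the strict
    inequality fails. *)
Theorem proposition1p3 (R : realType) (K : numFieldType)
    (hK : K = (R : numFieldType) \/ K = (R[i] : numFieldType))
    (X : completeNormedModType K)
    (hX : strictly_convex X) (rX : reflexive_space X)
    (T : {linear X -> c0 K}) (cT : compact_operator T)
    (T0 : exists x : X, T x <> 0) :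
  [/\ approximation_number 2 T = gelfand_number 2 T,
      gelfand_number 2 T < approximation_number 1 T,
      approximation_number 1 T = gelfand_number 1 T &
      gelfand_number 1 T = opnorm T].
Proof.
have cK := real_or_complex_complete hK.
have hbK := real_or_complex_hahn_banach hK.
rewrite approximation_number1 gelfand_number1; split => //.
  exact: approximation_eq_gelfand.
exact: gelfand_number2_lt.
Qed.
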